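(* Let $P_1,\dots,P_6$ be six generic points in the real (resp. complex) projective 3-space. Take a generic line $m_1$ that pierces the lines $(P_1P_2)$, $(P_3P_4)$, $(P_5P_6)$. Let $m_2$ be a line that pierces $m_1$ together with $(P_2P_3)$, $(P_4P_5)$, $(P_6P_1)$. Let $O=m_1\cap m_2$. Then the line $\ell_1$ that passes through $O$ and pierces $(P_1P_4)$ and $(P_2P_5)$ also pierces $(P_3P_6)$.
   Context: A line pierces another line if the two lines intersect. $(XY)$ denotes the line through two distinct points $X,Y$. ''Generic'' choices are choices belonging to a suitable Zariski dense subset of the appropriate configuration space; concretely, the assertion is that the conclusion holds for all choices in some nonempty Zariski open subset of the space of choices. *)

(* Defs.v *)
From HB Require Import structures.
From mathcomp Require Import all_boot all_order all_algebra.
From mathcomp Require Import reals.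
From mathcomp Require Import complex.
From mathcomp Require Import mpoly.

Set Implicit Arguments.
Unset Strict Implicit.
Unset Printing Implicit Defensive.

Import GRing.Theory.
Local Open Scope ring_scope.

(* Projective 3-space over K is the set of linear subspaces of K^4; a flat of
   projective dimension d is a linear subspace of dimension d + 1. *)
Record flat (K : fieldType) (d : nat) := Flat {
  flat_space :> {vspace 'rV[K]_4};
  flat_dim : \dim flat_space == d.+1 }.

Notation point K := (flat K 0).
Notation line K := (flat K 1).

HB.instance Definition _ (K : fieldType) (d : nat) :=
  [isSub for @flat_space K d].
HB.instance Definition _ (K : fieldType) (d : nat) :=
  [Equality of flat K d by <:].

(* For distinct X and Y this is the 2-dimensional subspace of K^4 that
   represents the line (XY). *)
Definition join (K : fieldType) (X Y : point K) : {vspace 'rV[K]_4} :=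
  (X + Y)%VS.

(* Two projective subspaces have a common point iff the corresponding linear
   subspaces have a nonzero intersection. *)
Definition pierces (K : fieldType) (L M : {vspace 'rV[K]_4}) : Prop :=
  (L :&: M)%VS != 0%VS.

Definition passes_through (K : fieldType) (L : {vspace 'rV[K]_4})
    (O : point K) : Prop :=
  (O <= L)%VS.

(* 1-based indexing: vertex P i is P_i and side P i j is the line (P_i P_j),
   for 1 <= i, j <= 6. *)
Definition vertex (K : fieldType) (P : 'I_6 -> point K) (i : nat) : point K :=
  P (inord i.-1).
Definition side (K : fieldType) (P : 'I_6 -> point K) (i j : nat) :
    {vspace 'rV[K]_4} :=
  join (vertex P i) (vertex P j).

Definition point_coord (K : fieldType) (X : point K) (j : 'I_4) : K :=
  vpick X 0 j.

(* All sixteen 2 x 2 minors of a basis of L are used; they are, up to sign and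
   zeros, the usual six Pluecker coordinates. *)
Definition pluecker_coord (K : fieldType) (L : line K) (i j : 'I_4) : K :=
  let a := (vbasis L)`_0 in let b := (vbasis L)`_1 in
  a 0 i * b 0 j - a 0 j * b 0 i.

(* Names of the homogeneous coordinates of (P_1, ..., P_6, m): inl (i, j) is the
   j-th coordinate of a point, inr (i, j) is a Pluecker coordinate of m. *)
Definition coord_index : finType := ('I_6 * 'I_4 + 'I_4 * 'I_4)%type.

(* The factor of (P^3)^6 x P^15 to which a coordinate belongs. *)
Definition coord_factor (t : coord_index) : option 'I_6 :=
  match t with inl ij => Some ij.1 | inr _ => None end.

Definition coord (K : fieldType) (P : 'I_6 -> point K) (m : line K)
    (t : coord_index) : K :=
  match t with
  | inl ij => point_coord (P ij.1) ij.2
  | inr ij => pluecker_coord m ij.1 ij.2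
  end.

Definition multihomogeneous (K : fieldType)
    (f : {mpoly K[#|coord_index|]}) : Prop :=
  exists d : option 'I_6 -> nat,
    forall (u : 'X_{1..#|coord_index|}) (c : option 'I_6), u \in msupp f ->
      (\sum_(k < #|coord_index| | coord_factor (enum_val k) == c) u k)%N = d c.

(* By multihomogeneity, whether f vanishes does not depend on the homogeneous
   coordinates chosen by point_coord and pluecker_coord. *)
Definition nonvanishing_at (K : fieldType) (f : {mpoly K[#|coord_index|]})
    (P : 'I_6 -> point K) (m : line K) : Prop :=
  f.@[fun k => coord P m (enum_val k)] != 0.

(* Zariski open subsets of (P^3)^6 x Gr(1, P^3): complements of common zero
   loci of families of multihomogeneous polynomials. *)
Definition zariski_open (K : fieldType)
    (U : ('I_6 -> point K) -> line K -> Prop) : Prop :=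
  exists S : {mpoly K[#|coord_index|]} -> Prop,
    (forall f, S f -> multihomogeneous f) /\
    (forall P m, U P m <-> exists2 f, S f & nonvanishing_at f P m).

(* C holds on a nonempty relatively Zariski open subset of the space of
   choices X. *)
Definition holds_generically (K : fieldType)
    (X C : ('I_6 -> point K) -> line K -> Prop) : Prop :=
  exists U : ('I_6 -> point K) -> line K -> Prop,
    [/\ zariski_open U,
        exists P m, X P m /\ U P m
      & forall P m, X P m -> U P m -> C P m].

(* Main.v *)
Require Import Defs.
From mathcomp Require Import all_boot all_order all_algebra.
From mathcomp Require Import reals.
From mathcomp Require Import complex.
From HB Require Import structures.
From mathcomp Require Import ring mpoly.

Set Implicit Arguments.
Unset Strict Implicit.
Unset Printing Implicit Defensive.

Import GRing.Theory.
Local Open Scope ring_scope.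

(** Write [xyzw] for the determinant of four vectors of K^4.  The lines that meet
    the three sides 12, 34, 56 of the hexagon sweep out the quadric
      Q(12,34,56)(o) = [o134][o256] - [o234][o156] = 0,
    because a point o lies on such a line iff, after projection from o, the three
    sides become concurrent.  Pappus' theorem, in the form that two triangles that
    are perspective in two ways are perspective in a third way, then amounts to
    the linear relation
      Q(12,34,56) + Q(14,25,36) = Q(23,45,61)
    between three quadratic forms ([regulus_form_pappus]).  The point O lies on
    m1, hence on the first quadric, and on m2, hence on the last one
    ([regulus_form_transversal]); so it lies on the middle one, and there the line
    through O that meets 14 and 25 also meets 36
    ([transversal_regulus_form]).

    Genericity makes the point O and the line through it well defined.  It is
    enough that P1, P2, P4, P5 are independent and that m1 misses 14, 25 and 23:
    then O is on neither 14 nor 25, these two lines are skew, and m1 differs from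
    m2.  Each of these four conditions is the nonvanishing of one bilinear
    expression in Pluecker coordinates, and the open set is the one where their
    product [generic_poly] does not vanish.  It contains an explicit hexagon with
    coordinates 0 and 1 ([nonvanishing_example]).  The argument is valid over
    every field. *)

(** * Brackets and the Klein form *)

Section KleinForm.

Variable A : comNzRingType.
Implicit Types (x y z w o : 'I_4 -> A) (p q : 'I_4 -> 'I_4 -> A).

Definition wedge x y (i j : 'I_4) : A := x i * y j - x j * y i.

(** The polar form of the Klein quadric; it vanishes at the Pluecker coordinates of
    two lines iff the lines meet. *)
Definition klein p q : A :=
  p 0 1 * q 2 3 - p 0 2 * q 1 3 + p 0 3 * q 1 2
  + p 1 2 * q 0 3 - p 1 3 * q 0 2 + p 2 3 * q 0 1.

(** The determinant of the four vectors, as its Laplace expansion along the first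
    two rows ([det_rows]).  This form lets the Pluecker coordinates of a line take
    the place of [wedge x y]. *)
Definition bracket x y z w : A := klein (wedge x y) (wedge z w).

(** As a function of [o], the equation of the quadric swept out by the common
    transversals of the lines ab, cd and ef. *)
Definition regulus_form o a b c d e f : A :=
  bracket o a c d * bracket o b e f - bracket o b c d * bracket o a e f.

(** Pappus' theorem: project from [o] to the plane.  If the first and the last form
    vanish, the triangles 135 and 246 are perspective in two ways, and the vanishing
    of the middle form is the third perspectivity. *)
Lemma regulus_form_pappus (o p1 p2 p3 p4 p5 p6 : 'I_4 -> A) :
  regulus_form o p1 p2 p3 p4 p5 p6 + regulus_form o p1 p4 p2 p5 p3 p6
  = regulus_form o p2 p3 p4 p5 p6 p1.
Proof. rewrite /regulus_form /bracket /klein /wedge; ring. Qed.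

(** Indexing by natural numbers lets the minors of a Laplace expansion compute. *)
Definition nat_det n (g : nat -> nat -> A) : A :=
  \det (\matrix_(i < n, j < n) g i j).

Lemma nat_det0 g : nat_det 0 g = 1.
Proof. exact: det_mx00. Qed.

Lemma nat_detS n g :
  nat_det n.+1 g = \sum_(k < n.+1)
    g 0%N k * ((-1) ^+ k * nat_det n (fun i j => g i.+1 (bump k j))).
Proof.
rewrite /nat_det (expand_det_row _ ord0); apply: eq_bigr => k _; rewrite mxE.
congr (_ * (_ * \det _)).
by apply/matrixP => i j; rewrite !mxE.
Qed.

Lemma det_rows (u : seq 'rV[A]_4) :
  \det (\matrix_(i < 4, j < 4) u`_i 0 j)
  = bracket (u`_0 0) (u`_1 0) (u`_2 0) (u`_3 0).
Proof.
pose g i j := u`_i 0 (inord j).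
have -> : \matrix_(i < 4, j < 4) u`_i 0 j = \matrix_(i < 4, j < 4) g i j.
  by apply/matrixP => i j; rewrite !mxE /g inord_val.
have gE i (j : 'I_4) : u`_i 0 j = g i j by rewrite /g inord_val.
rewrite -/(nat_det 4 g) /bracket /klein /wedge !gE /=.
do 4! rewrite !nat_detS !big_ord_recl !big_ord0 /=.
rewrite !nat_det0 /bump /= ?add0n ?addn0 ?add1n.
ring.
Qed.

End KleinForm.

Lemma rmorph_klein (A B : comNzRingType) (f : {rmorphism A -> B}) p q p' q' :
  (forall i j, f (p i j) = p' i j) -> (forall i j, f (q i j) = q' i j) ->
  f (klein p q) = klein p' q'.
Proof.
by move=> fp fq; rewrite /klein !(rmorphD, rmorphN, rmorphM) !fp !fq.
Qed.

Lemma rmorph_wedge (A B : comNzRingType) (f : {rmorphism A -> B}) x y i j :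
  f (wedge x y i j) = wedge (f \o x) (f \o y) i j.
Proof. by rewrite /wedge rmorphB !rmorphM. Qed.

(** * Multihomogeneity *)

Section Multihomogeneity.

Variable n : nat.

Lemma homog_wedge (K : comNzRingType) (mf : measure n) (k l : nat)
    (x y : 'I_4 -> {mpoly K[n]}) :
  (forall i, x i \is k.-homog for mf) -> (forall i, y i \is l.-homog for mf) ->
  forall i j, wedge x y i j \is (k + l).-homog for mf.
Proof. by move=> hx hy i j; rewrite rpredB // dhomogM. Qed.

Lemma homog_klein (K : comNzRingType) (mf : measure n) (k l : nat)
    (p q : 'I_4 -> 'I_4 -> {mpoly K[n]}) :
  (forall i j, p i j \is k.-homog for mf) ->
  (forall i j, q i j \is l.-homog for mf) ->
  klein p q \is (k + l).-homog for mf.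
Proof.
by move=> hp hq; rewrite /klein !(rpredB, rpredD) // ?rpredN dhomogM.
Qed.

End Multihomogeneity.

(** For each factor [c], this is a weighted degree, so that multihomogeneity is
    homogeneity for all of them at once. *)
Definition factor_degree (c : option 'I_6) (u : 'X_{1..#|coord_index|}) : nat :=
  (\sum_(k < #|coord_index| | coord_factor (enum_val k) == c) u k)%N.

Lemma factor_degree0 c : factor_degree c 0%MM = 0%N.
Proof. by rewrite /factor_degree big1 // => k _; rewrite mnm0E. Qed.

Lemma factor_degreeD c :
  {morph factor_degree c : u v / (u + v)%MM >-> (u + v)%N}.
Proof.
move=> u v; rewrite /factor_degree -big_split.
by apply: eq_bigr => k _; rewrite mnmDE.
Qed.

HB.instance Definition _ c :=
  isMeasure.Build #|coord_index| (factor_degree c)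
    (factor_degree0 c) (factor_degreeD c).

Section GenericPolynomial.

Variable K : fieldType.
Local Notation coord_ring := {mpoly K[#|coord_index|]}.

Definition coordX (t : coord_index) : coord_ring := 'X_(enum_rank t).

Lemma homog_coordX c t :
  coordX t \is (coord_factor t == c : nat).-homog for (factor_degree c).
Proof.
rewrite /coordX dhomogX /= /factor_degree; apply/eqP.
under eq_bigr => k _ do rewrite mnm1E.
rewrite big_mkcond (bigD1 (enum_rank t)) //= eqxx enum_rankK big1 ?addn0.
  by case: ifP.
by move=> k /negPf hk; rewrite [_ == k]eq_sym hk; case: ifP.
Qed.

Lemma meval_coordX P (m : line K) t :
  (coordX t).@[fun k => Defs.coord P m (enum_val k)] = Defs.coord P m t.
Proof. by rewrite mevalXU enum_rankK. Qed.

Definition vertexX (i : nat) (j : 'I_4) : coord_ring :=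
  coordX (inl (inord i.-1, j)).
Definition lineX (i j : 'I_4) : coord_ring := coordX (inr (i, j)).

(** Its factors say that 14 and 25 are skew, and that m misses 14, 25 and 23. *)
Definition generic_poly : coord_ring :=
  klein (wedge (vertexX 1) (vertexX 4)) (wedge (vertexX 2) (vertexX 5))
  * klein lineX (wedge (vertexX 1) (vertexX 4))
  * klein lineX (wedge (vertexX 2) (vertexX 5))
  * klein lineX (wedge (vertexX 2) (vertexX 3)).

Lemma multihomogeneous_generic_poly : multihomogeneous generic_poly.
Proof.
pose v i (c : option 'I_6) : nat := Some (inord i.-1) == c.
pose l (c : option 'I_6) : nat := None == c.
exists (fun c => (v 1 c + v 4 c + (v 2 c + v 5 c) + (l c + (v 1 c + v 4 c))
  + (l c + (v 2 c + v 5 c)) + (l c + (v 2 c + v 3 c)))%N) => u c.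
have hv i j : vertexX i j \is (v i c).-homog for (factor_degree c).
  exact: homog_coordX.
have hl i j : lineX i j \is (l c).-homog for (factor_degree c).
  exact: homog_coordX.
apply: (dhomogP (factor_degree c)).
by rewrite !dhomogM //; apply: homog_klein => // i j; apply: homog_wedge.
Qed.

Lemma nonvanishing_generic_poly P (m : line K) :
  let p i := vpick (vertex P i) 0 in
  nonvanishing_at generic_poly P m <->
  [/\ klein (wedge (p 1) (p 4)) (wedge (p 2) (p 5)) != 0,
      klein (pluecker_coord m) (wedge (p 1) (p 4)) != 0,
      klein (pluecker_coord m) (wedge (p 2) (p 5)) != 0
    & klein (pluecker_coord m) (wedge (p 2) (p 3)) != 0].
Proof.
move=> p; rewrite /nonvanishing_at /generic_poly !rmorphM.
have hw i k j l :
    (wedge (vertexX i) (vertexX k) j l).@[fun k => Defs.coord P m (enum_val k)]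
    = wedge (p i) (p k) j l.
  by rewrite rmorph_wedge /wedge /= !meval_coordX.
have hl j l : (lineX j l).@[fun k => Defs.coord P m (enum_val k)]
    = pluecker_coord m j l by rewrite meval_coordX.
rewrite (rmorph_klein (hw 1 4) (hw 2 5)) !(rmorph_klein hl (hw _ _)).
rewrite !mulf_eq0 !negb_or -!andbA.
by split=> [/and4P|[-> -> ->]].
Qed.

End GenericPolynomial.

(** * Transversals *)

Section Transversals.

Variable K : fieldType.
Implicit Types (a b c d e f o x y z w : 'rV[K]_4) (L M : {vspace 'rV[K]_4}).

Definition vol x y z w : K := bracket (x 0) (y 0) (z 0) (w 0).

Lemma vol_free x y z w : (vol x y z w != 0) = free [:: x; y; z; w].
Proof.
pose u := [tuple x; y; z; w].
have detE : \det (\matrix_(i < 4, j < 4) (u`_i) 0 j) = vol x y z w.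
  exact: det_rows.
have mulE (v : 'rV[K]_4) :
    v *m (\matrix_(i < 4, j < 4) (u`_i) 0 j) = \sum_(i < 4) v 0 i *: u`_i.
  rewrite mulmx_sum_row; apply: eq_bigr => i _; congr (_ *: _).
  by apply/rowP => j; rewrite !mxE.
apply/idP/(@freeP _ _ _ u) => [nz k sum0 i | indep].
  pose v : 'rV[K]_4 := \row_i k i.
  have : ~~ (v != 0).
    apply: contra nz => v0; rewrite -detE; apply/det0P; exists v => //.
    by rewrite mulE -[RHS]sum0; apply: eq_bigr => j _; rewrite mxE.
  by rewrite negbK => /eqP/rowP/(_ i); rewrite !mxE.
rewrite -detE; apply/det0P => -[v v0]; rewrite mulE => /indep z0.
by case/eqP: v0; apply/rowP => i; rewrite z0 mxE.
Qed.

Lemma vol_combl (s t : K) o x y c d :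
  vol o (s *: x + t *: y) c d = s * vol o x c d + t * vol o y c d.
Proof. rewrite /vol /bracket /klein /wedge !mxE; ring. Qed.

Lemma vol_free2 x y z w : free [:: x; y] -> free [:: z; w] ->
  (vol x y z w != 0) = (<<[:: x; y]>> :&: <<[:: z; w]>> == 0)%VS.
Proof.
move=> xy zw; rewrite vol_free (cat_free [:: x; y] [:: z; w]) xy zw /=.
by apply/directv_addP/eqP.
Qed.

Lemma vol_cap x y z w : vol x y z w != 0 ->
  free [:: x; y] /\ (<<[:: x; y]>> :&: <<[:: z; w]>> = 0)%VS.
Proof.
rewrite vol_free (cat_free [:: x; y] [:: z; w]).
by case/and3P => ? _ /directv_addP.
Qed.

Lemma memv_span2 x y w : w \in <<[:: x; y]>>%VS ->
  exists s t : K, w = s *: x + t *: y.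
Proof.
rewrite span_cons span_seq1 => /memv_addP[_ /vlineP[s ->] [_ /vlineP[t ->] ->]].
by exists s, t.
Qed.

Lemma span2_line x y L : \dim L = 2%N -> x \in L -> y \in L -> free [:: x; y] ->
  L = <<[:: x; y]>>%VS.
Proof.
move=> dL xL yL xy; apply/esym/eqP; rewrite eqEdim dL (eqnP xy) andbT.
by apply/span_subvP => z; rewrite !inE => /orP[]/eqP->.
Qed.

Lemma common_vector L M : (L :&: M != 0)%VS ->
  exists2 w, w != 0 & w \in L /\ w \in M.
Proof.
move=> LM; exists (vpick (L :&: M)%VS); first by rewrite vpick0.
by apply/andP; rewrite -memv_cap memv_pick.
Qed.

Lemma cap_neq0 w L M : w != 0 -> w \in L -> w \in M -> (L :&: M != 0)%VS.
Proof.
move=> w0 wL wM; apply: contra w0 => /eqP LM.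
by rewrite -memv0 -LM memv_cap wL.
Qed.

(** Both lines give a linear dependence: if [o] and [w] are independent they span
    [L], which meets xy. *)
Lemma vol_incident L o w x y : \dim L = 2%N -> o \in L -> w \in L ->
  (L :&: <<[:: x; y]>> != 0)%VS -> vol o w x y = 0.
Proof.
move=> dL oL wL; apply: contraNeq => /[dup] nz; rewrite vol_free.
rewrite (cat_free [:: o; w] [:: x; y]) => /and3P[ow xy _].
by rewrite (span2_line dL oL wL ow) -vol_free2.
Qed.

Lemma det2_eq0 (s t A B C D : K) : ~~ ((s == 0) && (t == 0)) ->
  s * A + t * B = 0 -> s * C + t * D = 0 -> A * D - B * C = 0.
Proof.
move=> st AB CD.
have Hs : s * (A * D - B * C) = 0.
  by transitivity (D * (s * A + t * B) - B * (s * C + t * D));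
    [ring | rewrite AB CD; ring].
have Ht : t * (A * D - B * C) = 0.
  by transitivity (A * (s * C + t * D) - C * (s * A + t * B));
    [ring | rewrite AB CD; ring].
apply/eqP; move/eqP: Hs; move/eqP: Ht; rewrite !mulf_eq0.
by case/orP => // t0 /orP[] // s0; rewrite s0 t0 in st.
Qed.

(** Let [w = s a + t b] be a point of [L] on ab.  As [L] meets cd and ef, both
    [o w c d] and [o w e f] vanish; these are two linear equations for (s, t) != 0,
    and their determinant is the regulus form. *)
Lemma regulus_form_transversal L o a b c d e f : \dim L = 2%N -> o \in L ->
  (L :&: <<[:: a; b]>> != 0)%VS -> (L :&: <<[:: c; d]>> != 0)%VS ->
  (L :&: <<[:: e; f]>> != 0)%VS ->
  regulus_form (o 0) (a 0) (b 0) (c 0) (d 0) (e 0) (f 0) = 0.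
Proof.
move=> dL oL /common_vector[w w0 [wL /memv_span2[s [t wE]]]] cd ef.
have := vol_incident dL oL wL ef; have := vol_incident dL oL wL cd.
rewrite wE !vol_combl; apply: det2_eq0.
apply: contra w0 => /andP[/eqP s0 /eqP t0].
by rewrite wE s0 t0 !scale0r addr0.
Qed.

(** Cramer's rule: in the basis a, b, c, d the two volumes are, up to sign and
    a nonzero factor, the coordinates of [o] at [b] and [a]. *)
Lemma mem_span2_vol o a b c d : free [:: a; b; c; d] ->
  vol o a c d = 0 -> vol o b c d = 0 -> o \in <<[:: c; d]>>%VS.
Proof.
move=> abcd; have nz := abcd; rewrite -vol_free in nz.
have : o \in <<[:: a; b; c; d]>>%VS.
  have -> : <<[:: a; b; c; d]>>%VS = fullv.
    by apply/eqP; rewrite eqEdim subvf (eqnP abcd) dimvf.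
  exact: memvf.
rewrite (span_cat [:: a; b] [:: c; d]).
case/memv_addP => u /memv_span2[s [t ->]] [v vcd ->].
have [p [q vE]] := memv_span2 vcd.
have -> : vol (s *: a + t *: b + v) a c d = - t * vol a b c d.
  by rewrite vE /vol /bracket /klein /wedge !mxE; ring.
have -> : vol (s *: a + t *: b + v) b c d = s * vol a b c d.
  by rewrite vE /vol /bracket /klein /wedge !mxE; ring.
move/eqP; rewrite mulf_eq0 oppr_eq0 (negPf nz) orbF => /eqP->.
move/eqP; rewrite mulf_eq0 (negPf nz) orbF => /eqP->.
by rewrite !scale0r !add0r.
Qed.

(** Converse of [regulus_form_transversal]: the point [s a + t b] of [L] on ab
    satisfies the equation of cd, which is nonzero as [o] is not on cd; the regulus
    form makes the equation of ef proportional to it. *)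
Lemma transversal_regulus_form L o a b c d e f : \dim L = 2%N -> o \in L ->
  free [:: a; b; c; d] -> free [:: e; f] ->
  o \notin <<[:: a; b]>>%VS -> o \notin <<[:: c; d]>>%VS ->
  (L :&: <<[:: a; b]>> != 0)%VS -> (L :&: <<[:: c; d]>> != 0)%VS ->
  regulus_form (o 0) (a 0) (b 0) (c 0) (d 0) (e 0) (f 0) = 0 ->
  (L :&: <<[:: e; f]>> != 0)%VS.
Proof.
move=> dL oL abcd ef oab ocd /common_vector[w w0 [wL wab]] cd Q0.
have ow : free [:: w; o].
  rewrite free_cons seq1_free span_seq1; apply/andP; split; last first.
    by apply: contra oab => /eqP->; rewrite mem0v.
  apply: contra oab => /vlineP[k wk].
  have k0 : k != 0 by apply: contra w0 => /eqP k0; rewrite wk k0 scale0r.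
  by rewrite -[o](scalerK k0) -wk memvZ.
have {}ow : free [:: o; w].
  rewrite (perm_free (_ : perm_eq _ [:: w; o])) //.
  by rewrite (perm_catC [:: o] [:: w]).
have [s [t wE]] := memv_span2 wab.
have := vol_incident dL oL wL cd; rewrite wE vol_combl => cd0.
rewrite (span2_line dL oL wL ow) -[_ == _]negbK -vol_free2 // negbK.
rewrite wE vol_combl.
set A := vol o a c d in cd0; set B := vol o b c d in cd0.
have AB : ~~ ((A == 0) && (B == 0)).
  by apply: contra ocd => /andP[/eqP A0 /eqP B0]; apply: (mem_span2_vol abcd).
have := @det2_eq0 A B s t (vol o b e f) (- vol o a e f) AB.
rewrite mulrN (mulrC A s) (mulrC B t) => /(_ cd0 Q0) /eqP.
by rewrite negbK mulrN -opprD oppr_eq0.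
Qed.

End Transversals.

(** * Lines through points *)

Section PointsAndLines.

Variable K : fieldType.
Implicit Types (X Y O : point K) (l m : line K).

Lemma point_span X : (X : {vspace 'rV[K]_4}) = <[vpick X]>%VS.
Proof.
apply/esym/eqP; rewrite eqEdim (eqP (flat_dim X)) -memvE memv_pick dim_vline.
by rewrite vpick0 -dimv_eq0 (eqP (flat_dim X)).
Qed.

Lemma join_span X Y : join X Y = <<[:: vpick X; vpick Y]>>%VS.
Proof. by rewrite span_cons span_seq1 -!point_span. Qed.

Lemma vpick_point_neq0 X : vpick X != 0.
Proof. by rewrite vpick0 -dimv_eq0 (eqP (flat_dim X)). Qed.

Lemma free_points X Y : X != Y -> free [:: vpick X; vpick Y].
Proof.
move=> XY; rewrite free_cons seq1_free vpick_point_neq0 andbT span_seq1.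
apply: contra XY; rewrite memvE -!point_span => sXY.
by apply/eqP/val_inj/eqP; rewrite eqEdim sXY !(eqP (flat_dim _)).
Qed.

Lemma dim_line l : \dim l = 2%N.
Proof. exact: eqP (flat_dim l). Qed.

Lemma point_sub_line X (L : {vspace 'rV[K]_4}) : (X <= L)%VS = (vpick X \in L).
Proof. by rewrite {1}point_span memvE. Qed.

Lemma klein_pierces m X Y : X != Y ->
  (klein (pluecker_coord m) (wedge (vpick X 0) (vpick Y 0)) != 0)
  = (m :&: join X Y == 0)%VS.
Proof.
move=> XY; have [fm sm] : free (vbasis m) /\ <<vbasis m>>%VS = m.
  by have /andP[/eqP ? ?] := vbasisP m.
have : size (vbasis m) = 2%N by rewrite size_tuple dim_line.
case E : (tval (vbasis m)) => [|a [|b []]] // _.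
rewrite E in fm sm; rewrite join_span -[in RHS]sm -vol_free2 // ?free_points //.
by rewrite /pluecker_coord E.
Qed.

(** [l] is spanned by [O] and its point on [L], which differs from [O]. *)
Lemma line_sub_plane l O (L : {vspace 'rV[K]_4}) :
  (O <= l)%VS -> (O :&: L = 0)%VS -> (l :&: L != 0)%VS -> (l <= O + L)%VS.
Proof.
move=> Ol OL lL; have dO := eqP (flat_dim O).
suff -> : (l : {vspace _}) = (O + l :&: L)%VS by rewrite addvS // capvSr.
apply/esym/eqP; rewrite eqEdim subv_add Ol capvSl dim_line /=.
have cap0 : (O :&: (l :&: L) = 0)%VS.
  by apply/eqP; rewrite -subv0 -OL capvS // capvSr.
rewrite dimv_disjoint_sum // dO add1n ltnS lt0n dimv_eq0 //.
Qed.

Lemma line_pierces_plane l (V L : {vspace 'rV[K]_4}) :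
  \dim V = 3%N -> \dim L = 2%N -> (l <= V)%VS -> (L <= V)%VS ->
  (l :&: L != 0)%VS.
Proof.
move=> dV dL lV LV; rewrite -dimv_eq0 -lt0n.
have := dimv_sum_cap l L; rewrite dim_line dL.
have : (\dim (l + L) <= 3)%N by rewrite -[leqRHS]dV dimvS // subv_add lV.
by case: (\dim (_ :&: _)) => // le3; rewrite addn0 => E; rewrite E in le3.
Qed.

(** The transversal is the intersection of the planes OL and OM, which are distinct
    because [L] and [M] are skew. *)
Lemma unique_transversal O (L M : {vspace 'rV[K]_4}) :
  \dim L = 2%N -> \dim M = 2%N -> (L :&: M = 0)%VS ->
  (O :&: L = 0)%VS -> (O :&: M = 0)%VS ->
  exists l, unique (fun l : line K =>
    [/\ passes_through l O, pierces l L & pierces l M]) l.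
Proof.
move=> dL dM LM OL OM; have dO := eqP (flat_dim O).
have dOL : \dim (O + L) = 3%N by rewrite dimv_disjoint_sum // dO dL.
have dOM : \dim (O + M) = 3%N by rewrite dimv_disjoint_sum // dO dM.
have full : \dim (O + L + (O + M)) = 4%N.
  apply/anti_leq/andP; split.
    by rewrite (leq_trans (dimvS (subvf _))) // dimvf.
  have dLM : \dim (L + M) = 4%N by rewrite dimv_disjoint_sum // dL dM.
  by rewrite -[leqLHS]dLM dimvS // addvS // addvSr.
have dl : \dim ((O + L) :&: (O + M)) == 2%N.
  by rewrite -(eqn_add2l (\dim (O + L + (O + M)))) dimv_sum_cap full dOL dOM.
exists (Flat dl); split=> [|l [Ol lL lM]].
  split; first by rewrite /passes_through subv_cap !addvSl.
  - by apply: (line_pierces_plane dOL) => //=; [exact: capvSl | exact: addvSr].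
  - by apply: (line_pierces_plane dOM) => //=; [exact: capvSr | exact: addvSr].
apply/val_inj/esym/eqP; rewrite eqEdim /= (eqP dl) dim_line andbT.
by rewrite subv_cap !line_sub_plane.
Qed.

End PointsAndLines.

(** * The generic hexagon *)

Section Hexagon.

Variable K : fieldType.

Definition special_hexagon (P : 'I_6 -> point K) (m1 : line K) : Prop :=
  [/\ injective P, pierces m1 (side P 1 2), pierces m1 (side P 3 4)
    & pierces m1 (side P 5 6)].

Lemma vertex_neq (P : 'I_6 -> point K) i j : injective P ->
  (0 < i <= 6)%N -> (0 < j <= 6)%N -> i != j -> vertex P i != vertex P j.
Proof.
case: i j => [|i] [|j] //= Pinj i6 j6; apply: contra => /eqP/Pinj/(congr1 val).
by rewrite /= !inordK // => ->.
Qed.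

Lemma hexagon_transversal (P : 'I_6 -> point K) (m1 m2 : line K) :
  special_hexagon P m1 -> nonvanishing_at (generic_poly K) P m1 ->
  pierces m2 m1 -> pierces m2 (side P 2 3) ->
  pierces m2 (side P 4 5) -> pierces m2 (side P 6 1) ->
  exists O : point K,
    (m1 :&: m2)%VS = O /\
    exists l1 : line K,
      unique (fun l : line K =>
                [/\ passes_through l O, pierces l (side P 1 4)
                  & pierces l (side P 2 5)]) l1 /\
      pierces l1 (side P 3 6).
Proof.
move=> [Pinj m12 m34 m56] /nonvanishing_generic_poly[skew nz14 nz25 nz23].
move=> m2m1 m2_23 m2_45 m2_61.
have vneq i j := @vertex_neq P i j Pinj.
have m1N23 : (m1 :&: side P 2 3 = 0)%VS.
  by apply/eqP; rewrite -klein_pierces // vneq.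
have m1N14 : (m1 :&: side P 1 4 = 0)%VS.
  by apply/eqP; rewrite -klein_pierces // vneq.
have m1N25 : (m1 :&: side P 2 5 = 0)%VS.
  by apply/eqP; rewrite -klein_pierces // vneq.
(* Otherwise [m2] would be [m1], but [m2] meets 23. *)
have dO : \dim (m1 :&: m2) == 1%N.
  rewrite eqn_leq lt0n dimv_eq0 capvC m2m1 andbT -ltnS -[ltnRHS](dim_line m2).
  rewrite ltn_neqAle dimvS ?capvSl // andbT; apply: contraL m2_23 => /eqP dcap.
  have /eqP sub : (m2 :&: m1 == m2)%VS by rewrite eqEdim capvSl dcap leqnn.
  rewrite negbK -subv0 -m1N23 capvS // -sub; exact: capvSr.
pose O : point K := Flat dO; exists O; split=> //.
have Om1 : (O <= m1)%VS by apply: capvSl.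
have Om2 : (O <= m2)%VS by apply: capvSr.
(* [O] inherits from [m1] that it avoids 14 and 25. *)
have miss (L : {vspace 'rV[K]_4}) : (m1 :&: L = 0 -> O :&: L = 0)%VS.
  by move=> mL; apply/eqP; rewrite -subv0 -mL capvS.
have O14 := miss _ m1N14; have O25 := miss _ m1N25.
have dim_side i j : (0 < i <= 6)%N -> (0 < j <= 6)%N -> i != j ->
    \dim (side P i j) = 2%N.
  move=> i6 j6 ij; rewrite /side join_span.
  exact: (eqnP (free_points (vneq i j i6 j6 ij))).
have indep := skew; rewrite -[klein _ _]/(vol _ _ _ _) vol_free in indep.
have skew0 : (side P 1 4 :&: side P 2 5 = 0)%VS.
  by apply/eqP; rewrite /side !join_span -vol_free2 ?free_points ?vneq.
have [l1 l1P] := unique_transversal (dim_side 1 4 isT isT isT)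
  (dim_side 2 5 isT isT isT) skew0 O14 O25.
exists l1; split=> //; case: l1P => -[Ol1 l14 l25] _.
have notin X Y : (O :&: join X Y = 0)%VS ->
    vpick O \notin <<[:: vpick X; vpick Y]>>%VS.
  rewrite -join_span => OXY; apply: contra (vpick_point_neq0 O) => oXY.
  by rewrite -memv0 -OXY memv_cap memv_pick.
move: (Om1) (Om2) (Ol1); rewrite /passes_through !point_sub_line => om1 om2 ol1.
rewrite /pierces /side !join_span in m12 m34 m56 m2_23 m2_45 m2_61 l14 l25 *.
apply: (transversal_regulus_form (dim_line l1) ol1 indep) => //.
- by rewrite free_points ?vneq.
- exact: notin.
- exact: notin.
have := regulus_form_transversal (dim_line m2) om2 m2_23 m2_45 m2_61.
rewrite -regulus_form_pappus.
by rewrite (regulus_form_transversal (dim_line m1) om1 m12 m34 m56) add0r.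
Qed.

End Hexagon.

(** * An explicit hexagon *)

Section Example.

Variable K : fieldType.

Definition row4 (a b c d : K) : 'rV[K]_4 := \row_(j < 4) [:: a; b; c; d]`_j.

(** P1, P2, P4, P5 are the coordinate points.  P3 is on the line through P4 and
    (1,1,0,0), a point of 12, and P6 on the line through P5 and the same point, so
    that every line through (1,1,0,0) meets 12, 34 and 56. *)
Definition example_vertex (i : nat) : 'rV[K]_4 :=
  nth 0 [:: row4 1 0 0 0; row4 0 1 0 0; row4 1 1 1 0;
            row4 0 0 1 0; row4 0 0 0 1; row4 1 1 0 1] i.

Lemma example_vertex_scale (i j : 'I_6) (k : K) :
  example_vertex i = k *: example_vertex j -> i = j.
Proof.
have n10 : (1 == 0 :> K) = false by rewrite oner_eq0.
have n01 : (0 == 1 :> K) = false by rewrite eq_sym.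
(* The vertices have entries 0 and 1, so a relation between two different ones
   gives 1 = 0 in some coordinate, or 0 = k in one and 1 = k in another. *)
have k01 : (0 == k) && (1 == k) = false.
  by apply/negP => /andP[/eqP <-]; rewrite n10.
move=> /rowP E; move: (E 0) (E 1) (E 2) (E 3) => {E}.
case: i j => [[|[|[|[|[|[|i]]]]]] i6] [[|[|[|[|[|[|j]]]]]] j6] //=;
  rewrite /example_vertex /= !mxE /= ?mulr0 ?mulr1;
  move=> /eqP E0 /eqP E1 /eqP E2 /eqP E3; try exact: val_inj;
  by move: E0 E1 E2 E3 k01; rewrite ?n01 ?n10 ?eqxx //; do 2!case: (_ == k).
Qed.

Lemma example_vertex_neq0 (i : 'I_6) : example_vertex i != 0.
Proof.
(* A zero vector would be a multiple of a vertex of another index. *)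
pose j : 'I_6 := inord (i == 0%N :> nat).
apply/eqP => i0; have := @example_vertex_scale i j 0.
rewrite i0 scale0r => /(_ erefl) /(congr1 val) /=.
by rewrite inordK; case: (val i) => [|[]].
Qed.

Lemma dim_example_point i : \dim <[example_vertex (i : 'I_6)]> == 1%N.
Proof. by rewrite dim_vline example_vertex_neq0. Qed.

Definition example_hexagon (i : 'I_6) : point K := Flat (dim_example_point i).

Lemma vol_row4 a0 a1 a2 a3 b0 b1 b2 b3 c0 c1 c2 c3 d0 d1 d2 d3 :
  vol (row4 a0 a1 a2 a3) (row4 b0 b1 b2 b3) (row4 c0 c1 c2 c3)
      (row4 d0 d1 d2 d3) =
  (a0 * b1 - a1 * b0) * (c2 * d3 - c3 * d2)
  - (a0 * b2 - a2 * b0) * (c1 * d3 - c3 * d1)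
  + (a0 * b3 - a3 * b0) * (c1 * d2 - c2 * d1)
  + (a1 * b2 - a2 * b1) * (c0 * d3 - c3 * d0)
  - (a1 * b3 - a3 * b1) * (c0 * d2 - c2 * d0)
  + (a2 * b3 - a3 * b2) * (c0 * d1 - c1 * d0).
Proof. by rewrite /vol /bracket /klein /wedge !mxE. Qed.

Definition row4E := (vol_row4, mul0r, mulr0, mul1r, mulr1, subr0, sub0r,
  addr0, add0r, oppr0, mulrN1, mulN1r, (@opprK K), oppr_eq0, oner_eq0).

Definition example_line_space : {vspace 'rV[K]_4} :=
  <<[:: row4 1 1 0 0; row4 0 0 1 1]>>%VS.

Lemma dim_example_line : \dim example_line_space == 2%N.
Proof.
have [|fab _] := @vol_cap K (row4 1 1 0 0) (row4 0 0 1 1)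
  (row4 1 0 0 0) (row4 0 0 1 0).
  by rewrite !row4E.
by rewrite /example_line_space (eqnP fab).
Qed.

Definition example_line : line K := Flat dim_example_line.

Lemma side_example i j : (0 < i <= 6)%N -> (0 < j <= 6)%N ->
  side example_hexagon i j
  = <<[:: example_vertex i.-1; example_vertex j.-1]>>%VS.
Proof.
case: i j => [|i] [|j] //= i6 j6.
by rewrite /side /join /vertex /= !inordK // span_cons span_seq1.
Qed.

Lemma special_example : special_hexagon example_hexagon example_line.
Proof.
have a0 : row4 1 1 0 0 != 0.
  by apply/eqP => /rowP/(_ 0); rewrite !mxE => /eqP; rewrite oner_eq0.
have am : row4 1 1 0 0 \in example_line_space by rewrite memv_span ?mem_head.
split.
- move=> i j /(congr1 (@flat_space _ _)) /= E.
  have : example_vertex i \in <[example_vertex j]>%VS by rewrite -E memv_line.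
  by case/vlineP => k /example_vertex_scale.
- apply: (cap_neq0 a0 am); rewrite side_example //.
  have -> : row4 1 1 0 0 = example_vertex 0 + example_vertex 1.
    by apply/rowP => j; rewrite !mxE; case: j => [[|[|[|[|j]]]] //= _]; ring.
  by rewrite rpredD // memv_span ?inE ?eqxx ?orbT.
- apply: (cap_neq0 a0 am); rewrite side_example //.
  have -> : row4 1 1 0 0 = example_vertex 2 - example_vertex 3.
    by apply/rowP => j; rewrite !mxE; case: j => [[|[|[|[|j]]]] //= _]; ring.
  by rewrite rpredB // memv_span ?inE ?eqxx ?orbT.
- apply: (cap_neq0 a0 am); rewrite side_example //.
  have -> : row4 1 1 0 0 = example_vertex 5 - example_vertex 4.
    by apply/rowP => j; rewrite !mxE; case: j => [[|[|[|[|j]]]] //= _]; ring.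
  by rewrite rpredB // memv_span ?inE ?eqxx ?orbT.
Qed.

Lemma nonvanishing_example :
  nonvanishing_at (generic_poly K) example_hexagon example_line.
Proof.
have [inj_ex _ _ _] := special_example.
have neq i j : (0 < i <= 6)%N -> (0 < j <= 6)%N -> i != j ->
    vertex example_hexagon i != vertex example_hexagon j.
  exact: vertex_neq.
have miss i j : (0 < i <= 6)%N -> (0 < j <= 6)%N -> i != j ->
    vol (row4 1 1 0 0) (row4 0 0 1 1)
        (example_vertex i.-1) (example_vertex j.-1) != 0 ->
    klein (pluecker_coord example_line)
      (wedge (vpick (vertex example_hexagon i) 0)
             (vpick (vertex example_hexagon j) 0)) != 0.
  move=> i6 j6 ij /vol_cap[_ cap0].
  rewrite klein_pierces ?neq // -/(side _ _ _) side_example //; exact/eqP.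
apply/nonvanishing_generic_poly; split; try by apply: miss; rewrite ?row4E.
rewrite -[klein _ _]/(vol _ _ _ _) vol_free2 ?free_points ?neq //.
rewrite -!join_span -!/(side _ _ _) !side_example //.
by apply/eqP; apply: (proj2 (vol_cap _)); rewrite !row4E.
Qed.

End Example.

Theorem theorem5p13 (R : realType) :
  let claim (K : fieldType) : Prop :=
    holds_generically
      (fun (P : 'I_6 -> point K) (m1 : line K) =>
         [/\ injective P, pierces m1 (side P 1 2), pierces m1 (side P 3 4)
           & pierces m1 (side P 5 6)])
      (fun (P : 'I_6 -> point K) (m1 : line K) =>
         forall m2 : line K,
           pierces m2 m1 -> pierces m2 (side P 2 3) ->
           pierces m2 (side P 4 5) -> pierces m2 (side P 6 1) ->
           exists O : point K,
             (m1 :&: m2)%VS = O /\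
             exists l1 : line K,
               unique (fun l : line K =>
                         [/\ passes_through l O, pierces l (side P 1 4)
                           & pierces l (side P 2 5)]) l1 /\
               pierces l1 (side P 3 6)) in
  claim R /\ claim R[i]%C.
Proof.
move=> claim; suff claimP K : claim K by [].
exists (nonvanishing_at (generic_poly K)); split.
- exists (eq (generic_poly K)); split=> [f <- | P m].
    exact: multihomogeneous_generic_poly.
  by split=> [nz | [f <-]]; [exists (generic_poly K) |].
- exists (example_hexagon K), (example_line K).
  by split; [exact: special_example | exact: nonvanishing_example].
- by move=> P m1 XP UP m2; apply: hexagon_transversal.
Qed.
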